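(* Let $c,t,x,y,z\in\mathbb{R}$ and let $X\in\mathbb{H}_{\mathbb{C}}$ be the biquaternion $$X=ct\,\mathbf{1}+I(x\mathbf{i}+y\mathbf{j}+z\mathbf{k}).$$ Under the algebra isomorphism $\Psi:\mathbb{H}_{\mathbb{C}}\to\mathcal{M}_2(\mathbb{C})$ given by $I\mapsto iI_2$ and $$\mathbf{1}\mapsto\begin{pmatrix} 1 & 0 \\ 0 & 1 \end{pmatrix},\quad\mathbf{i}\mapsto\begin{pmatrix} 0 & -i \\ -i & 0 \end{pmatrix},\quad\mathbf{j}\mapsto\begin{pmatrix} 0 & -1 \\ 1 & 0 \end{pmatrix},\quad\mathbf{k}\mapsto\begin{pmatrix} -i & 0 \\ 0 & i \end{pmatrix},$$ the matrix representative of $X$ is the Hermitian matrix $$\Psi(X)=\begin{pmatrix} ct+z & x-iy \\ x+iy & ct-z \end{pmatrix},$$ and its determinant is the Minkowski interval: $$\det(\Psi(X))=c^2t^2-(x^2+y^2+z^2)=s^2.$$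
   Context: $\mathbb{H}$ is Hamilton's quaternion algebra over $\mathbb{R}$ with basis $\mathbf{1},\mathbf{i},\mathbf{j},\mathbf{k}$, $\mathbf{i}^2=\mathbf{j}^2=\mathbf{k}^2=\mathbf{i}\mathbf{j}\mathbf{k}=-1$. The biquaternion algebra is $\mathbb{H}_{\mathbb{C}}=\mathbb{H}\otimes_{\mathbb{R}}\mathbb{C}=\{q+Ip: q,p\in\mathbb{H}\}$, where $I$ is the complex imaginary unit, $I^2=-1$, commuting with $\mathbf{i},\mathbf{j},\mathbf{k}$. $s^2:=c^2t^2-(x^2+y^2+z^2)$ denotes the Minkowski spacetime interval. *)

(* Defs.v *)
From HB Require Import structures.
From mathcomp Require Import all_boot all_order all_algebra.
From mathcomp Require Import complex reals.
From mathcomp Require Import ring.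

Set Implicit Arguments.
Unset Strict Implicit.
Unset Printing Implicit Defensive.

Import Order.TTheory GRing.Theory Num.Theory.

Local Open Scope ring_scope.
Local Open Scope complex_scope.

Section Quaternions.
Variable R : realType.

(* Quat a b c d is a + b i + c j + d k *)
Record quat := Quat { q0 : R; q1 : R; q2 : R; q3 : R }.

Definition quat_tuple (q : quat) := (q0 q, q1 q, q2 q, q3 q).
Definition tuple_quat (u : R * R * R * R) :=
  let: (a, b, c, d) := u in Quat a b c d.

Lemma quat_tupleK : cancel quat_tuple tuple_quat.
Proof. by case. Qed.

HB.instance Definition _ := Choice.copy quat (can_type quat_tupleK).

Definition quat_opp (p : quat) := Quat (- q0 p) (- q1 p) (- q2 p) (- q3 p).
Definition quat_add (p q : quat) :=
  Quat (q0 p + q0 q) (q1 p + q1 q) (q2 p + q2 q) (q3 p + q3 q).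
Definition quat_scale (a : R) (p : quat) :=
  Quat (a * q0 p) (a * q1 p) (a * q2 p) (a * q3 p).
Definition quat_mul (p q : quat) := Quat
  (q0 p * q0 q - q1 p * q1 q - q2 p * q2 q - q3 p * q3 q)
  (q0 p * q1 q + q1 p * q0 q + q2 p * q3 q - q3 p * q2 q)
  (q0 p * q2 q - q1 p * q3 q + q2 p * q0 q + q3 p * q1 q)
  (q0 p * q3 q + q1 p * q2 q - q2 p * q1 q + q3 p * q0 q).

Fact quat_addA : associative quat_add.
Proof. by move=> p q r; congr Quat; rewrite /= addrA. Qed.
Fact quat_addC : commutative quat_add.
Proof. by move=> p q; congr Quat; rewrite /= addrC. Qed.
Fact quat_add0 : left_id (Quat 0 0 0 0) quat_add.
Proof. by case=> *; congr Quat; rewrite /= add0r. Qed.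
Fact quat_addN : left_inverse (Quat 0 0 0 0) quat_opp quat_add.
Proof. by move=> p; congr Quat; rewrite /= addNr. Qed.

HB.instance Definition _ :=
  GRing.isZmodule.Build quat quat_addA quat_addC quat_add0 quat_addN.

Fact quat_mulA : associative quat_mul.
Proof. by move=> p q r; congr Quat => /=; ring. Qed.
Fact quat_mul1l : left_id (Quat 1 0 0 0) quat_mul.
Proof. by case=> *; congr Quat => /=; ring. Qed.
Fact quat_mul1r : right_id (Quat 1 0 0 0) quat_mul.
Proof. by case=> *; congr Quat => /=; ring. Qed.
Fact quat_mulDl : left_distributive quat_mul +%R.
Proof. by move=> p q r; congr Quat => /=; ring. Qed.
Fact quat_mulDr : right_distributive quat_mul +%R.
Proof. by move=> p q r; congr Quat => /=; ring. Qed.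
Fact quat_1neq0 : Quat 1 0 0 0 != 0.
Proof. by apply/eqP => -[] /eqP; rewrite oner_eq0. Qed.

HB.instance Definition _ := GRing.Zmodule_isNzRing.Build quat
  quat_mulA quat_mul1l quat_mul1r quat_mulDl quat_mulDr quat_1neq0.

Fact quat_scaleA a b p : quat_scale a (quat_scale b p) = quat_scale (a * b) p.
Proof. by congr Quat => /=; ring. Qed.
Fact quat_scale1 : left_id 1 quat_scale.
Proof. by case=> *; congr Quat => /=; ring. Qed.
Fact quat_scaleDr : right_distributive quat_scale +%R.
Proof. by move=> a p q; congr Quat => /=; ring. Qed.
Fact quat_scaleDl p : {morph quat_scale^~ p : a b / a + b}.
Proof. by move=> a b; congr Quat => /=; ring. Qed.

HB.instance Definition _ := GRing.Zmodule_isLmodule.Build R quat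
  quat_scaleA quat_scale1 quat_scaleDr quat_scaleDl.

Fact quat_scaleAl (a : R) (p q : quat) : a *: (p * q) = (a *: p) * q.
Proof. by congr Quat => /=; ring. Qed.
HB.instance Definition _ := GRing.Lmodule_isLalgebra.Build R quat quat_scaleAl.

Fact quat_scaleAr (a : R) (p q : quat) : a *: (p * q) = p * (a *: q).
Proof. by congr Quat => /=; ring. Qed.
HB.instance Definition _ := GRing.Lalgebra_isAlgebra.Build R quat quat_scaleAr.

Definition qi := Quat 0 1 0 0.
Definition qj := Quat 0 0 1 0.
Definition qk := Quat 0 0 0 1.

Lemma quat_relations :
  [/\ qi ^+ 2 = -1, qj ^+ 2 = -1, qk ^+ 2 = -1 & qi * qj * qk = -1].
Proof. by split; congr Quat => /=; ring. Qed.

Lemma quat_basis (q : quat) :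
  q = q0 q *: 1 + q1 q *: qi + q2 q *: qj + q3 q *: qk.
Proof. by case: q => *; congr Quat => /=; ring. Qed.

End Quaternions.

Arguments qi {R}.
Arguments qj {R}.
Arguments qk {R}.

Section Biquaternions.
Variable R : realType.
Local Notation H := (quat R).

(* Biquat q p is q + I p *)
Record biquat := Biquat { bre : H; bim : H }.

Definition biquat_pair (w : biquat) := (bre w, bim w).
Definition pair_biquat (u : H * H) := Biquat u.1 u.2.

Lemma biquat_pairK : cancel biquat_pair pair_biquat.
Proof. by case. Qed.

HB.instance Definition _ := Choice.copy biquat (can_type biquat_pairK).

Definition biquat_opp (v : biquat) := Biquat (- bre v) (- bim v).
Definition biquat_add (v w : biquat) :=
  Biquat (bre v + bre w) (bim v + bim w).
Definition biquat_mul (v w : biquat) := Biquat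
  (bre v * bre w - bim v * bim w) (bre v * bim w + bim v * bre w).
(* the complex number a + i b acts as a + I b *)
Definition biquat_scale (a : R[i]) (w : biquat) := Biquat
  (complex.Re a *: bre w - complex.Im a *: bim w)
  (complex.Re a *: bim w + complex.Im a *: bre w).

Fact biquat_addA : associative biquat_add.
Proof. by move=> u v w; congr Biquat; rewrite /= addrA. Qed.
Fact biquat_addC : commutative biquat_add.
Proof. by move=> u v; congr Biquat; rewrite /= addrC. Qed.
Fact biquat_add0 : left_id (Biquat 0 0) biquat_add.
Proof. by case=> *; congr Biquat; rewrite /= add0r. Qed.
Fact biquat_addN : left_inverse (Biquat 0 0) biquat_opp biquat_add.
Proof. by move=> v; congr Biquat; rewrite /= addNr. Qed.

HB.instance Definition _ := GRing.isZmodule.Build biquat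
  biquat_addA biquat_addC biquat_add0 biquat_addN.

Fact biquat_mulA : associative biquat_mul.
Proof.
by move=> [[? ? ? ?] [? ? ? ?]] [[? ? ? ?] [? ? ? ?]] [[? ? ? ?] [? ? ? ?]];
  congr Biquat; congr Quat => /=; ring.
Qed.
Fact biquat_mul1l : left_id (Biquat 1 0) biquat_mul.
Proof. by case=> q p; congr Biquat; rewrite /= !mul1r mul0r ?subr0 ?addr0. Qed.
Fact biquat_mul1r : right_id (Biquat 1 0) biquat_mul.
Proof. by case=> q p; congr Biquat; rewrite /= !mulr1 mulr0 ?subr0 ?add0r. Qed.
Fact biquat_mulDl : left_distributive biquat_mul +%R.
Proof.
by move=> [[? ? ? ?] [? ? ? ?]] [[? ? ? ?] [? ? ? ?]] [[? ? ? ?] [? ? ? ?]];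
  congr Biquat; congr Quat => /=; ring.
Qed.
Fact biquat_mulDr : right_distributive biquat_mul +%R.
Proof.
by move=> [[? ? ? ?] [? ? ? ?]] [[? ? ? ?] [? ? ? ?]] [[? ? ? ?] [? ? ? ?]];
  congr Biquat; congr Quat => /=; ring.
Qed.
Fact biquat_1neq0 : Biquat 1 0 != 0.
Proof. by apply/eqP => -[] /eqP; rewrite oner_eq0. Qed.

HB.instance Definition _ := GRing.Zmodule_isNzRing.Build biquat
  biquat_mulA biquat_mul1l biquat_mul1r biquat_mulDl biquat_mulDr biquat_1neq0.

Fact biquat_scaleA a b w :
  biquat_scale a (biquat_scale b w) = biquat_scale (a * b) w.
Proof.
by case: a b w => [? ?] [? ?] [[? ? ? ?] [? ? ? ?]];
  congr Biquat; congr Quat => /=; ring.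
Qed.
Fact biquat_scale1 : left_id 1 biquat_scale.
Proof.
by case=> [[? ? ? ?] [? ? ? ?]]; congr Biquat; congr Quat => /=; ring.
Qed.
Fact biquat_scaleDr : right_distributive biquat_scale +%R.
Proof.
by move=> [? ?] [[? ? ? ?] [? ? ? ?]] [[? ? ? ?] [? ? ? ?]];
  congr Biquat; congr Quat => /=; ring.
Qed.
Fact biquat_scaleDl w : {morph biquat_scale^~ w : a b / a + b}.
Proof.
by case: w => [[? ? ? ?] [? ? ? ?]] [? ?] [? ?];
  congr Biquat; congr Quat => /=; ring.
Qed.

HB.instance Definition _ := GRing.Zmodule_isLmodule.Build R[i] biquat
  biquat_scaleA biquat_scale1 biquat_scaleDr biquat_scaleDl.

Fact biquat_scaleAl (a : R[i]) (v w : biquat) : a *: (v * w) = (a *: v) * w.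
Proof.
by case: a v w => [? ?] [[? ? ? ?] [? ? ? ?]] [[? ? ? ?] [? ? ? ?]];
  congr Biquat; congr Quat => /=; ring.
Qed.
HB.instance Definition _ :=
  GRing.Lmodule_isLalgebra.Build R[i] biquat biquat_scaleAl.

Fact biquat_scaleAr (a : R[i]) (v w : biquat) : a *: (v * w) = v * (a *: w).
Proof.
by case: a v w => [? ?] [[? ? ? ?] [? ? ? ?]] [[? ? ? ?] [? ? ? ?]];
  congr Biquat; congr Quat => /=; ring.
Qed.
HB.instance Definition _ :=
  GRing.Lalgebra_isAlgebra.Build R[i] biquat biquat_scaleAr.

Definition of_quat (q : H) : biquat := Biquat q 0.
Definition bI : biquat := Biquat 0 1.

Lemma biquatE (w : biquat) : w = of_quat (bre w) + bI * of_quat (bim w).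
Proof.
by case: w => [[? ? ? ?] [? ? ? ?]]; congr Biquat; congr Quat => /=; ring.
Qed.

Lemma bI_sqr : bI ^+ 2 = -1.
Proof. by congr Biquat; congr Quat => /=; ring. Qed.

Lemma bI_comm (q : H) : bI * of_quat q = of_quat q * bI.
Proof. by case: q => *; congr Biquat; congr Quat => /=; ring. Qed.

Lemma bI_scale : 'i%C *: 1 = bI.
Proof. by congr Biquat; congr Quat => /=; ring. Qed.

(* the 2 x 2 matrix with rows (a, b) and (c, d) *)
Definition mx22 (a b c d : R[i]) : 'M[R[i]]_2 :=
  \matrix_(i < 2, j < 2)
    if i == 0 then (if j == 0 then a else b) else (if j == 0 then c else d).

Definition psi_quat (q : H) : 'M[R[i]]_2 :=
  (q0 q)%:C *: mx22 1 0 0 1 + (q1 q)%:C *: mx22 0 (- 'i%C) (- 'i%C) 0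
  + (q2 q)%:C *: mx22 0 (-1) 1 0 + (q3 q)%:C *: mx22 (- 'i%C) 0 0 'i%C.

(* the extension of the values of psi_quat on 1, i, j, k along I |-> i *)
Definition Psi (w : biquat) : 'M[R[i]]_2 :=
  psi_quat (bre w) + ('i%C)%:M *m psi_quat (bim w).

End Biquaternions.

Arguments bI {R}.

Definition event_biquat (R : realType) (c t x y z : R) : biquat R :=
  of_quat ((c * t) *: 1) + bI * of_quat (x *: qi + y *: qj + z *: qk).

Definition interval_sqr (R : realType) (c t x y z : R) : R :=
  c ^+ 2 * t ^+ 2 - (x ^+ 2 + y ^+ 2 + z ^+ 2).

(* Main.v *)
Require Import Defs.
From mathcomp Require Import all_boot all_order all_algebra.
From mathcomp Require Import complex reals.
From mathcomp Require Import ring.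

(** A biquaternion [q + I p] is a complex combination
    [a 1 + b i + c j + d k], with [a = q0 + I p0], ..., [d = q3 + I p3], and
    [Psi] sends it to the matrix with rows [a - 'i d, - c - 'i b] and
    [c - 'i b, a + 'i d] ([PsiE]).

    In this form [Psi] is visibly complex linear.  It is multiplicative because
    the images of [i], [j], [k] satisfy the relations of Hamilton; on entries
    this is a polynomial identity in the sixteen real coordinates of the two
    factors ([Psi_monoid_morphism]).  It is bijective because sums and
    differences of the entries on each diagonal recover, up to sign, [2 a],
    [2 'i d], [2 c] and [2 'i b], and [2] is invertible ([Psi_bijective]).

    For the event [c t + I (x i + y j + z k)] the scalar coordinate is real and
    the three others are purely imaginary, so that the four factors ['i] in the
    entries turn [x] and [z] into real numbers and leave [y] multiplied by
    ['i].  The matrix is then its own conjugate transpose, and its determinant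
    is [(ct + z) (ct - z) - (x - 'i y) (x + 'i y)]. *)

Import GRing.Theory Num.Theory.

Local Open Scope ring_scope.
Local Open Scope complex_scope.

Lemma mx22E (R : realType) (M : 'M[R[i]]_2) :
  M = mx22 (M 0 0) (M 0 1) (M 1 0) (M 1 1).
Proof.
by apply/matrixP => i j; rewrite mxE;
  case: i j => [[|[|//]] ?] [[|[|//]] ?] /=; congr (M _ _); apply: val_inj.
Qed.

Lemma add_mx22 (R : realType) (a b c d a' b' c' d' : R[i]) :
  mx22 a b c d + mx22 a' b' c' d' = mx22 (a + a') (b + b') (c + c') (d + d').
Proof. by rewrite [LHS]mx22E !mxE. Qed.

Lemma scale_mx22 (R : realType) (k a b c d : R[i]) :
  k *: mx22 a b c d = mx22 (k * a) (k * b) (k * c) (k * d).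
Proof. by rewrite [LHS]mx22E !mxE. Qed.

Lemma mul_mx22 (R : realType) (a b c d a' b' c' d' : R[i]) :
  mx22 a b c d *m mx22 a' b' c' d' =
  mx22 (a * a' + b * c') (a * b' + b * d') (c * a' + d * c') (c * b' + d * d').
Proof. by rewrite [LHS]mx22E !mxE !big_ord_recl !big_ord0 !mxE /= !addr0. Qed.

Lemma scalar_mx22 (R : realType) (a : R[i]) : a%:M = mx22 a 0 0 a.
Proof. by rewrite [LHS]mx22E !mxE. Qed.

Lemma det_mx22 (R : realType) (a b c d : R[i]) :
  \det (mx22 a b c d) = a * d - b * c.
Proof.
rewrite (expand_det_row _ 0) !big_ord_recl big_ord0 addr0 /cofactor !det_mx11.
by rewrite !mxE /= expr0 expr1 mul1r mulN1r mulrN.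
Qed.

Lemma hermsymmx_mx22 (R : realType) (a b c d : R[i]) :
  a^* = a -> b^* = c -> d^* = d -> mx22 a b c d \is hermsymmx.
Proof.
move=> aa bc dd; apply/is_hermitianmxP; rewrite expr0 scale1r.
have cb : c^* = b by rewrite -bc conjcK.
by rewrite [RHS]mx22E !mxE /=; congr mx22.
Qed.

(** The entries [a - 'i d], [- c - 'i b], [c - 'i b] and [a + 'i d], where
    [a = q0 + 'i p0], ..., [d = q3 + 'i p3], split into real and imaginary
    parts.  Complex identities about [Psi] thereby become polynomial identities
    between real coordinates. *)
Lemma PsiE (R : realType) (w : biquat R) :
  let q := bre w in let p := bim w in
  Psi w =
  mx22 ((q0 q + q3 p) +i* (q0 p - q3 q)) ((q1 p - q2 q) +i* (- q1 q - q2 p))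
       ((q2 q + q1 p) +i* (q2 p - q1 q)) ((q0 q - q3 p) +i* (q0 p + q3 q)).
Proof.
rewrite /Psi /psi_quat mul_scalar_mx !(add_mx22, scale_mx22) /=.
by congr mx22; congr Complex => /=; ring.
Qed.

Lemma Psi_linear (R : realType) : linear (@Psi R).
Proof.
move=> [a b] [[? ? ? ?] [? ? ? ?]] [[? ? ? ?] [? ? ? ?]].
rewrite !PsiE !(scale_mx22, add_mx22) /=.
by congr mx22; congr Complex => /=; ring.
Qed.

Lemma Psi_monoid_morphism (R : realType) : monoid_morphism (@Psi R).
Proof.
split=> [|[[? ? ? ?] [? ? ? ?]] [[? ? ? ?] [? ? ? ?]]].
  by rewrite PsiE [RHS]scalar_mx22 /=; congr mx22; congr Complex; ring.
rewrite !PsiE [RHS]mul_mx22 /=.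
by congr mx22; congr Complex => /=; ring.
Qed.

(** Solving the system given by the entries of [PsiE] for the complex
    coordinates [a], [b], [c], [d] of a biquaternion. *)
Definition Psi_inv (R : realType) (M : 'M[R[i]]_2) : biquat R :=
  let half (u : R[i]) := (2^-1)%:C * u in
  let a := half (M 0 0 + M 1 1) in
  let b := half ('i%C * (M 0 1 + M 1 0)) in
  let c := half (M 1 0 - M 0 1) in
  let d := half ('i%C * (M 0 0 - M 1 1)) in
  Biquat (Quat (complex.Re a) (complex.Re b) (complex.Re c) (complex.Re d))
         (Quat (complex.Im a) (complex.Im b) (complex.Im c) (complex.Im d)).

Lemma Psi_bijective (R : realType) : bijective (@Psi R).
Proof.
exists (@Psi_inv R) => [[[? ? ? ?] [? ? ? ?]]|M].
  by rewrite PsiE /Psi_inv !mxE /=; congr Biquat; congr Quat; field.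
rewrite [RHS]mx22E PsiE /=.
case: (M 0 0) (M 0 1) (M 1 0) (M 1 1) => [? ?] [? ?] [? ?] [? ?] /=.
by congr mx22; congr Complex; field.
Qed.

Lemma Psi_event (R : realType) (c t x y z : R) :
  Psi (event_biquat c t x y z) =
  mx22 ((c * t)%:C + z%:C) (x%:C - 'i%C * y%:C)
       (x%:C + 'i%C * y%:C) ((c * t)%:C - z%:C).
Proof.
rewrite PsiE /=.
by congr mx22; congr Complex => /=; ring.
Qed.

Theorem theorem13p3 (R : realType) (c t x y z : R) :
  [/\ linear (@Psi R), monoid_morphism (@Psi R) & bijective (@Psi R)] /\
  [/\ Psi (bI : biquat R) = ('i%C)%:M,
      Psi (of_quat (1 : quat R)) = mx22 1 0 0 1,
      Psi (of_quat (qi : quat R)) = mx22 0 (- 'i%C) (- 'i%C) 0,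
      Psi (of_quat (qj : quat R)) = mx22 0 (- 1) 1 0 &
      Psi (of_quat (qk : quat R)) = mx22 (- 'i%C) 0 0 'i%C] /\
  [/\ Psi (event_biquat c t x y z)
        = mx22 ((c * t)%:C + z%:C) (x%:C - 'i%C * y%:C)
               (x%:C + 'i%C * y%:C)  ((c * t)%:C - z%:C),
      Psi (event_biquat c t x y z) \is hermsymmx,
      \det (Psi (event_biquat c t x y z))
        = (c ^+ 2 * t ^+ 2 - (x ^+ 2 + y ^+ 2 + z ^+ 2))%:C &
      c ^+ 2 * t ^+ 2 - (x ^+ 2 + y ^+ 2 + z ^+ 2)
        = interval_sqr c t x y z].
Proof.
split; [|split].
- split; [exact: Psi_linear|exact: Psi_monoid_morphism|exact: Psi_bijective].
- by split; rewrite PsiE ?scalar_mx22 /=; congr mx22; congr Complex => /=; ring.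
- rewrite Psi_event; split=> //.
  + by apply: hermsymmx_mx22; congr Complex => /=; ring.
  + by rewrite det_mx22; congr Complex => /=; ring.
Qed.
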